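(* Let $G$ be a finite group. Then $G$ is exp-simple if and only if $\exp(G) = \exp(G/N)$ for all proper normal subgroups $N$ of $G$.
   Context: All groups are finite, and $\exp(G)$ denotes the exponent of $G$. A subgroup $H \le G$ is called exponential with respect to $G$ if $x^{|G:H|} \in H$ for all $x \in G$. A subgroup $H \le G$ is called exp-trivial if either $H = G$ or $\exp(G)$ divides $|G:H|$. The group $G$ is called exp-simple if every exponential subgroup of $G$ is exp-trivial. *)

(* Defs.v *)
From HB Require Import structures.
From mathcomp Require Import all_boot all_fingroup all_solvable.

Set Implicit Arguments.
Unset Strict Implicit.
Unset Printing Implicit Defensive.

Import GroupScope.

(* The inclusion H \subset G is not part of the next two predicates;
   it is required where they are used, in exp_simple. *)
Definition exponential (gT : finGroupType) (G H : {group gT}) : Prop :=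
  forall x, x \in G -> x ^+ #|G : H| \in H.

Definition exp_trivial (gT : finGroupType) (G H : {group gT}) : Prop :=
  H :=: G \/ exponent G %| #|G : H|.

Definition exp_simple (gT : finGroupType) (G : {group gT}) : Prop :=
  forall H : {group gT}, H \subset G -> exponential G H -> exp_trivial G H.

(* Main.v *)
Require Import Defs.
From mathcomp Require Import all_boot all_fingroup all_solvable.

(** Write [Q] for [G / N].

    If a subgroup [H] contains [N] and [exponent Q] divides [#|G : H|], then
    [H] is exponential, since [x ^+ #|G : H|] dies in [Q].  When [G] is
    exp-simple, such an [H], if proper, forces [exponent G] to divide
    [#|G : H|].  It remains to choose [H] with an index carrying as small a
    power of a given prime [p] as possible: let [H / N] be a [p]-subgroup of [Q] of
    order [#|Q|`_p %/ (exponent Q)`_p], so that [#|G : H|] is a multiple of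
    [exponent Q] with the same [p]-part ([pgroup_of_index]).  Hence the
    [p]-part of [exponent G] divides [exponent Q] for every [p], and the two
    exponents agree.

    Conversely, an exponential subgroup [H] of index [d] contains all [d]-th
    powers, hence the normal subgroup [N] that they generate.  If [H] is proper
    then so is [N], and [exponent G = exponent (G / N)] divides [d]. *)

Set Implicit Arguments.
Unset Strict Implicit.
Unset Printing Implicit Defensive.

Import GroupScope.

(** A [p]-group has subgroups of every order dividing its own; applied to a
    Sylow [p]-subgroup of [G], this lets the [p]-part of the index of a
    [p]-subgroup be any power of [p] dividing [#|G|]. *)
Lemma pgroup_of_index (gT : finGroupType) (G : {group gT}) (p n : nat) :
    prime p -> n %| #|G| ->
  exists K : {group gT},
    [/\ K \subset G, p.-group K & #|G : K| = (#|G|`_p^' * n`_p)%N].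
Proof.
move=> p_pr n_dv; have [P sylP] := Sylow_exists p G.
have sPG := pHall_sub sylP; have pP := pHall_pgroup sylP.
have np_dv : n`_p %| #|P| by rewrite (card_Hall sylP) partn_dvd.
have n_gt0 : 0 < n by apply: dvdn_gt0 n_dv.
have [K [sKP _ oK]] := normal_pgroup pP (normal_refl P) (leq_subr (logn p n) _).
exists K; split; [exact: subset_trans sPG | exact: pgroupS pP |].
have le_np : logn p n <= logn p #|P|.
  by move: np_dv; rewrite p_part pfactor_dvdn.
apply/eqP; rewrite -(eqn_pmul2l (cardG_gt0 K)) Lagrange ?(subset_trans sKP) //.
rewrite mulnCA oK p_part -expnD subnK // (card_Hall sylP) logn_part.
by rewrite -p_part mulnC partnC.
Qed.

Lemma exponential_quotient (gT : finGroupType) (G H N : {group gT}) :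
    N <| G -> N \subset H -> exponent (G / N) %| #|G : H| ->
  exponential G H.
Proof.
move=> /andP[_ nNG] sNH /exponentP expGN x Gx.
have Nx := subsetP nNG x Gx.
apply: (subsetP sNH); apply: coset_idr; first by rewrite groupX.
by rewrite morphX // expGN ?mem_quotient.
Qed.

Lemma exp_simple_exponent_quotient (gT : finGroupType) (G N : {group gT}) :
  exp_simple G -> N <| G -> N \proper G -> exponent G = exponent (G / N).
Proof.
move=> simpG nsNG prNG; have nNG := normal_norm nsNG.
apply/eqP; rewrite eqn_dvd exponent_quotient andbT.
apply/dvdn_partP=> [|p]; first exact: exponent_gt0.
rewrite mem_primes => /and3P[p_pr _ _].
set Q := (G / N)%G.
have [K [sKQ pK iK]] := pgroup_of_index p_pr (exponent_dvdn Q).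
have [H defK sNH sHG] := inv_quotientS nsNG sKQ.
have iH : #|G : H| = (#|Q|`_p^' * (exponent Q)`_p)%N.
  rewrite -iK defK index_quotient_eq //.
  by rewrite (subset_trans _ sNH) ?subsetIr.
have expQ_dv : exponent Q %| #|G : H|.
  rewrite iH -{1}(partnC p (exponent_gt0 Q)) mulnC dvdn_mul //.
  by rewrite partn_dvd ?exponent_dvdn.
have [defH | expG_dv] := simpG H sHG (exponential_quotient nsNG sNH expQ_dv).
  (* H = G would make Q a p-group of exponent prime to p, hence trivial. *)
  case/negP: (proper_subn prNG); rewrite -quotient_sub1 //.
  have pQ : p.-group Q by rewrite /pgroup /= -defH -defK.
  have := iH; rewrite defH indexgg => /esym/eqP.
  rewrite muln_eq1 => /andP[_ /eqP e1].
  have eQ : p.-nat (exponent Q) by rewrite pnat_exponent.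
  by rewrite subG1 trivg_exponent -[exponent _](part_pnat_id eQ) e1.
apply: dvdn_trans (dvdn_part p _).
have := partn_dvd p (indexg_gt0 G H) expG_dv.
rewrite iH partnM ?part_gt0 // (part_p'nat (part_pnat p^' _)) mul1n.
by rewrite (part_pnat_id (part_pnat p _)).
Qed.

Lemma exp_simple_of_exponent_quotient (gT : finGroupType) (G : {group gT}) :
    (forall N : {group gT}, N <| G -> N \proper G ->
       exponent G = exponent (G / N)) ->
  exp_simple G.
Proof.
move=> expG H sHG expH.
have [defH | neHG] := eqVneq (H : {set gT}) G; first by left.
right; set d := #|G : H|.
pose N := <<[set x ^+ d | x in G]>>%G.
have sNH : N \subset H.
  by rewrite gen_subG; apply/subsetP=> _ /imsetP[x Gx ->]; apply: expH.
have nNG : G \subset 'N(N).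
  apply: norms_gen; apply/subsetP=> g Gg; rewrite inE.
  apply/subsetP=> _ /imsetP[_ /imsetP[x Gx ->] ->].
  by rewrite conjXg (imset_f (fun z => z ^+ d)) ?groupJ.
have prHG : H \proper G by rewrite properEneq neHG.
rewrite (expG N) ?(sub_proper_trans sNH) // /normal ?(subset_trans sNH) //.
apply/exponentP=> _ /morphimP[x Nx Gx ->].
by rewrite -morphX //= coset_id // mem_gen ?(imset_f (fun z => z ^+ d)).
Qed.

Theorem theorem1p3 (gT : finGroupType) (G : {group gT}) :
  exp_simple G <->
  (forall N : {group gT}, N <| G -> N \proper G ->
     exponent G = exponent (G / N)).
Proof.
split=> [simpG N|]; first exact: exp_simple_exponent_quotient.
exact: exp_simple_of_exponent_quotient.
Qed.
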